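(* Let $q$ be a square-free positive integer, $\epsilon>0$, and $h$ a positive integer. For each prime $p\mid q$ let $\Omega_p\subset\mathbb{Z}/p\mathbb{Z}$ with $|\Omega_p|=c_p\,p$ and $p-|\Omega_p|>p^{1/2+\epsilon}$, and suppose that $\big|\sum_{x\in\Omega_p}e(ax/p)\big|<c'_p\sqrt{p}$ for all $a\not\equiv 0\pmod p$, where $c_p,c'_p<1$. Then $$\sum_{n=0}^{q-1}\Bigg(\#\{m:\ n+1\le m\le n+h,\ m\bmod p\notin\Omega_p\ \text{for all } p\mid q\}-h\prod_{p\mid q}\frac{p-|\Omega_p|}{p}\Bigg)^2\le q\,h\prod_{p\mid q}\Big((1-c_p)^2+c_p'^{\,2}\Big).$$
   Context: $e(x)=e^{2\pi i x}$. *)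

(* Defs.v *)
From HB Require Import structures.
From mathcomp Require Import all_boot all_order all_algebra.
From mathcomp Require Import all_classical all_reals all_analysis.
From mathcomp Require Import complex.

Set Implicit Arguments.
Unset Strict Implicit.
Unset Printing Implicit Defensive.

Import Order.TTheory GRing.Theory Num.Theory.

Local Open Scope ring_scope.
Local Open Scope complex_scope.

Definition squarefree (n : nat) : Prop :=
  forall d : nat, (d ^ 2 %| n)%N -> d = 1%N.

(* e^(x + iy) = e^x (cos y + i sin y) *)
Definition cexp (R : realType) (z : R[i]) : R[i] :=
  (expR (complex.Re z))%:C * (cos (complex.Im z) +i* sin (complex.Im z)).

Definition e (R : realType) (x : R) : R[i] := cexp (0 +i* (2 * pi * x)).
Arguments e {R} x.

(* Z/pZ is 'Z_p, the ring of integers mod p for p >= 2; only the values of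
   Omega at the primes dividing q matter. *)
Definition sifted_count (q : nat) (Omega : forall p : nat, {set 'Z_p})
    (n h : nat) : nat :=
  count (fun m : nat => all (fun p : nat => (m%:R : 'Z_p) \notin Omega p)
                            (primes q))
        (index_iota n.+1 (n + h).+1).

(* Main.v *)
(* The sifted set is periodic modulo q; by Parseval on Z/q the variance equals
   1/q times the sum over a <> 0 of |f^(a)|^2 |sum_(m < h) e(a m / q)|^2, where f
   is the indicator of the sifted set.  By the Chinese remainder theorem f^
   factors over p | q, and |f^(a)|^2 <= q^2 prod_p ([p | a] A_p + B_p / p) with
   A_p = (1 - c_p)^2 and B_p = c'_p^2.  Expanding this product, each divisor d of
   q contributes sums over the nonzero fractions b/d, and Parseval on Z/d gives
   sum_(0 < b < d) |sum_(m < h) e(b m / d)|^2 <= d h, because complete periods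
   vanish and h may be replaced by its remainder modulo d. *)

Require Import Defs.
From mathcomp Require Import all_boot all_order all_algebra.
From mathcomp Require Import all_classical all_reals all_analysis.
From mathcomp Require Import complex ring.

Set Implicit Arguments.
Unset Strict Implicit.
Unset Printing Implicit Defensive.

Import Order.TTheory GRing.Theory Num.Theory.

Local Open Scope ring_scope.
Local Open Scope complex_scope.

(** * The additive character [e] and its orthogonality relations *)

Lemma eE (R : realType) (x : R) : e x = cos (2 * pi * x) +i* sin (2 * pi * x).
Proof. by rewrite /e /cexp /= expR0 mul1r. Qed.

Lemma eD (R : realType) (x y : R) : e (x + y) = e x * e y.
Proof.
rewrite !eE mulrDr cosD sinD; apply/eqP.
by rewrite eq_complex /= eqxx addrC eqxx.
Qed.

Lemma e0 (R : realType) : e (0 : R) = 1.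
Proof. by rewrite eE mulr0 cos0 sin0. Qed.

Lemma conjcM (R : rcfType) (x y : R[i]) : (x * y)^* = x^*%C * y^*%C.
Proof. exact: rmorphM. Qed.

Lemma conj_e (R : realType) (x : R) : (e x)^* = e (- x).
Proof. by rewrite !eE mulrN cosN sinN. Qed.

Lemma norm_e (R : realType) (x : R) : `|e x| = 1.
Proof. by rewrite normc_def eE /= cos2Dsin2 sqrtr1. Qed.

Lemma eMn (R : realType) (x : R) (n : nat) : e (x * n%:R) = e x ^+ n.
Proof.
by elim: n => [|n IH]; rewrite ?mulr0 ?e0 // -addn1 natrD mulrDr mulr1 eD IH exprD.
Qed.

Lemma e_nat (R : realType) (n : nat) : e (n%:R : R) = 1.
Proof.
rewrite -[n%:R]mul1r eMn eE mulr1 mulr_natl cos2pi sin2pi.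
by rewrite (_ : 1 +i* 0 = 1) // expr1n.
Qed.

Lemma e_int (R : realType) (k : int) : e (k%:~R : R) = 1.
Proof.
case: k => n; first exact: e_nat.
by rewrite NegzE mulrNz -conj_e e_nat conjc1.
Qed.

(** The real part is cos(2 pi x) = cos(pi x)^2 - sin(pi x)^2 = 1 - 2 sin(pi x)^2, and sin(pi x) is
    positive for 0 < x < 1. *)
Lemma e_neq1 (R : realType) (x : R) : 0 < x < 1 -> e x != 1.
Proof.
move=> /andP[x0 x1]; rewrite eE eq_complex /= negb_and; apply/orP; left.
have s0 : 0 < sin (pi * x).
  by rewrite sin_gt0_pi// mulr_gt0 ?pi_gt0//= gtr_pMr ?pi_gt0.
rewrite -mulrA mulr_natl mulr2n cosD -!expr2 cos2sin2 lt_eqF//.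
rewrite ltrBlDr ltrBlDr -addrA ltrDl.
by rewrite addr_gt0 // exprn_gt0.
Qed.

Lemma e_frac_eq1 (R : realType) (d : nat) (k : int) : (0 < d)%N ->
  (e (k%:~R / d%:R : R) == 1) = (d %| k)%Z.
Proof.
move=> d0; have dR : (d%:R : R) != 0 by rewrite pnatr_eq0 -lt0n.
rewrite {1}(divz_eq k d) intrD intrM mulrDl mulfK// eD e_int mul1r.
have r0 : 0 <= (k %% d)%Z by rewrite modz_ge0 // -lt0n.
have rd : (k %% d)%Z < d%:Z by rewrite ltz_pmod.
have [E|N] := eqVneq (k %% d)%Z 0.
  by rewrite E mul0r e0 eqxx; apply/esym/dvdz_mod0P.
rewrite (negbTE (e_neq1 _)); last first.
  apply/andP; split; first by rewrite divr_gt0 ?ltr0n ?ltr0z ?lt_def ?N.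
  by rewrite ltr_pdivrMr ?ltr0n // mul1r -[d%:R]/(d%:Z%:~R) ltr_int.
by apply/esym/negbTE; apply: contra N => /dvdz_mod0P ->.
Qed.

Lemma sum_e (R : realType) (d : nat) (k : int) : (0 < d)%N ->
  \sum_(n < d) e (k%:~R * n%:R / d%:R : R) = if (d %| k)%Z then d%:R else 0.
Proof.
move=> d0; have dR : (d%:R : R) != 0 by rewrite pnatr_eq0 -lt0n.
under eq_bigr do rewrite mulrAC eMn.
rewrite -(e_frac_eq1 R k d0); case: eqVneq => [->|N].
  by under eq_bigr do rewrite expr1n; rewrite sumr_const card_ord.
(* Geometric series: multiplied by its ratio minus 1, the sum telescopes to [e k - 1], which is
   0. *)
apply: (mulfI (_ : e (k%:~R / d%:R) - 1 != 0)); first by rewrite subr_eq0.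
by rewrite mulr0 -subrX1 -eMn divfK// e_int subrr.
Qed.

Lemma e_frac_modn (R : realType) (d : nat) (a : int) (n : nat) : (0 < d)%N ->
  e (a%:~R * (n %% d)%:R / d%:R : R) = e (a%:~R * n%:R / d%:R).
Proof.
move=> d0; have dR : (d%:R : R) != 0 by rewrite pnatr_eq0 -lt0n.
rewrite [in RHS](divn_eq n d) natrD natrM mulrDr mulrDl eD.
rewrite mulrA mulfK // -[(n %/ d)%:R]/((n %/ d)%:Z%:~R) -intrM e_int.
by rewrite mul1r.
Qed.

(** * The discrete Fourier transform and Parseval's identity *)

Definition dft (R : realType) (d : nat) (F : nat -> R[i]) (a : int) : R[i] :=
  \sum_(n < d) F n * e (a%:~R * n%:R / d%:R).

(** Expanding the squared modulus gives a triple sum; summing over [a] first, orthogonality leaves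
    only the diagonal [n = m]. *)
Lemma parseval (R : realType) (d : nat) (F : nat -> R[i]) : (0 < d)%N ->
  \sum_(a < d) `|dft d F (a : nat)| ^+ 2 = d%:R * \sum_(n < d) `|F n| ^+ 2.
Proof.
move=> d0.
transitivity (\sum_(a < d) \sum_(n < d) \sum_(m < d)
    F n * (F m)^*%C * e ((n%:Z - m%:Z)%:~R * a%:R / d%:R : R)).
  apply: eq_bigr => a _; rewrite sqr_normc.
  have -> : (dft d F (a : nat))^* =
      \sum_(m < d) (F m)^*%C * e (- (a%:R * m%:R / d%:R)).
    by rewrite [LHS]rmorph_sum; apply: eq_bigr => m _; rewrite -conj_e -conjcM.
  rewrite mulr_suml.
  apply: eq_bigr => n _; rewrite mulr_sumr; apply: eq_bigr => m _.
  rewrite mulrACA -eD; congr (_ * e _).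
  by rewrite intrD mulrNz -!pmulrn; ring.
rewrite exchange_big mulr_sumr; apply: eq_bigr => n _.
rewrite exchange_big /= (bigD1 n) //= [X in _ + X]big1 => [|m mn].
  by rewrite -mulr_sumr sum_e // subrr dvdz0 addr0 sqr_normc mulrC.
rewrite -mulr_sumr sum_e // ifN ?mulr0 //.
apply: contraNN mn => dnm; rewrite eq_sym -val_eqE /=.
by rewrite -eqz_mod_dvd !modz_nat !modn_small in dnm.
Qed.

(** * Factorization by the Chinese remainder theorem *)

Lemma sum_coprime (T : comPzSemiRingType) (a b : nat) (F G : nat -> T) :
  (0 < a)%N -> (0 < b)%N -> coprime a b ->
  (forall n, F (n %% a)%N = F n) -> (forall n, G (n %% b)%N = G n) ->
  \sum_(n < a * b) F n * G n = (\sum_(n < a) F n) * (\sum_(n < b) G n).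
Proof.
move=> a0 b0 co_ab Fa Gb; rewrite big_distrlr /= pair_bigA /=.
(* The pair of residues is injective by the Chinese remainder theorem, hence bijective by
   counting. *)
pose f (n : 'I_(a * b)) := (Ordinal (ltn_pmod n a0), Ordinal (ltn_pmod n b0)).
have f_bij : bijective f.
  apply: inj_card_bij => [m n [/eqP mna /eqP mnb]|].
    apply/val_inj/eqP; rewrite /= -(modn_small (ltn_ord m)).
    by rewrite -[X in _ == X](modn_small (ltn_ord n)) chinese_remainder ?mna.
  by rewrite card_prod !card_ord.
rewrite (reindex f) /=; last exact: onW_bij.
by apply: eq_bigr => n _; rewrite Fa Gb.
Qed.

Lemma prod_prime_gt0 (s : seq nat) : all prime s -> (0 < \prod_(p <- s) p)%N.
Proof.
by move=> /allP ps; rewrite big_seq prodn_cond_gt0 // => p /ps/prime_gt0.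
Qed.

Lemma coprime_prod_prime (p : nat) (s : seq nat) :
  prime p -> all prime s -> p \notin s -> coprime p (\prod_(r <- s) r).
Proof.
move=> pp; elim: s => [|r s IH] /=; first by rewrite big_nil coprimen1.
rewrite inE negb_or big_cons coprimeMr => /andP[rp ps] /andP[pr pNs].
by rewrite IH // prime_coprime // dvdn_prime2 // pr.
Qed.

Lemma sum_prod_prime (T : comPzSemiRingType) (s : seq nat) (F : nat -> nat -> T) :
  uniq s -> all prime s ->
  (forall p, p \in s -> forall n, F p (n %% p)%N = F p n) ->
  \sum_(n < \prod_(p <- s) p) \prod_(p <- s) F p n
    = \prod_(p <- s) \sum_(n < p) F p n.
Proof.
elim: s => [|p s IH] => [_ _ _|/= /andP[pNs us] /andP[pp ps] Fp].
  by rewrite !big_nil big_ord1 big_nil.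
have Fs r : r \in s -> forall n, F r (n %% r)%N = F r n.
  by move=> rs; apply: Fp; rewrite inE rs orbT.
rewrite !big_cons -IH //.
rewrite -(@sum_coprime _ _ _ (F p) (fun n => \prod_(r <- s) F r n));
  rewrite ?prod_prime_gt0 ?prime_gt0 //.
- by apply: eq_bigr => n _; rewrite big_cons.
- exact: coprime_prod_prime.
- by apply: Fp; rewrite mem_head.
move=> n; apply: eq_big_seq => r rs.
rewrite -Fs // modn_dvdm ?Fs //.
by rewrite (big_rem r) //= dvdn_mulr.
Qed.

(* Partial fractions: [a / prod p] is congruent to [sum (b p / p)] modulo 1,
   which exponentiation by [e] turns into an equality. *)
Lemma e_partial_fraction (R : realType) (s : seq nat) :
  uniq s -> all prime s -> forall a : int, exists b : nat -> int,
    (forall p, p \in s -> (p %| b p)%Z = (p %| a)%Z) /\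
    forall n : nat, e (a%:~R * n%:R / (\prod_(p <- s) p)%:R : R)
      = \prod_(p <- s) e ((b p)%:~R * n%:R / p%:R).
Proof.
elim: s => [|p s IH] => [_ _ a|/= /andP[pNs us] /andP[pp ps] a].
  exists (fun=> 0); split=> // n.
  by rewrite !big_nil divr1 -[n%:R]/(n%:Z%:~R) -intrM e_int.
set Q := (\prod_(r <- s) r)%N in IH *.
have co_pQ : coprimez p Q by rewrite coprimezE; apply: coprime_prod_prime.
have [[u v] /= uv1] := coprimezP _ _ co_pQ.
have [b [b_dvd b_e]] := IH us ps (a * u).
(* From u p + v Q = 1 follows a/(p Q) = a v/p + a u/Q; the induction hypothesis splits the second
   fraction. The multipliers [v] modulo [p] and [u] modulo each prime of [s] are units, so
   divisibility is unchanged. *)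
exists (fun r => if r == p then a * v else b r); split.
  move=> r; rewrite inE; case: eqVneq => /= [-> _|_ rs].
    rewrite Gauss_dvdzl //; apply/coprimezP; exists (u, Q%:Z) => /=.
    by rewrite [Q%:Z * v]mulrC.
  rewrite b_dvd // Gauss_dvdzl //; apply/coprimezP.
  have /dvdnP[k Qk] : (r %| Q)%N by rewrite /Q (big_rem r) //= dvdn_mulr.
  exists (v * k, p%:Z) => /=.
  by rewrite -uv1 Qk PoszM addrC [p%:Z * u]mulrC mulrA.
move=> n; rewrite !big_cons eqxx -/Q.
rewrite (eq_big_seq (fun r => e ((b r)%:~R * n%:R / r%:R))); last first.
  by move=> r rs; rewrite ifN //; apply: contraNneq pNs => <-.
rewrite -b_e -eD; congr (e _).
have pR : p%:R != 0 :> R by rewrite pnatr_eq0 -lt0n prime_gt0.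
have QR : Q%:R != 0 :> R by rewrite pnatr_eq0 -lt0n prod_prime_gt0.
have uvR : u%:~R * p%:R + v%:~R * Q%:R = 1 :> R.
  by rewrite -[p%:R]/(p%:Z%:~R) -[Q%:R]/(Q%:Z%:~R) -!intrM -intrD uv1.
transitivity (a%:~R * (u%:~R * p%:R + v%:~R * Q%:R) * n%:R / (p * Q)%:R : R).
  by rewrite uvR mulr1.
by rewrite natrM !intrM; field; rewrite pR QR.
Qed.

(** * Exponential sums over an interval, averaged over fractions *)

Definition expsum (R : realType) (h : nat) (x : R) : R[i] :=
  \sum_(m < h) e (x * m%:R).

(** A complete period of [d] terms sums to zero since [d] does not divide [a]; the induction removes
    [h %/ d] such periods. *)
Lemma expsum_modn (R : realType) (h d a : nat) : (0 < a < d)%N ->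
  expsum h (a%:R / d%:R : R) = expsum (h %% d) (a%:R / d%:R).
Proof.
move=> /andP[a0 ad]; have d0 := ltn_trans a0 ad.
rewrite [in LHS](divn_eq h d); move: (h %% d)%N => r; move: (h %/ d)%N => k.
elim: k => [|k IH]; first by rewrite mul0n add0n.
rewrite -[RHS]IH mulSnr addnAC /expsum big_split_ord /= -[RHS]addr0.
congr (_ + _); under eq_bigr do rewrite natrD mulrDr eD.
rewrite -mulr_sumr; under eq_bigr do rewrite mulrAC.
rewrite (sum_e R a d0) ifN ?mulr0 //.
by rewrite dvdzE /= gtnNdvd.
Qed.

(** Once [h] is reduced modulo [d], the interval fits in one period and [expsum] is the transform of
    its indicator. Parseval then gives at most d (h mod d), which is at most d h. *)
Lemma expsum_sq_sum (R : realType) (h d : nat) : (0 < d)%N ->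
  \sum_(1 <= a < d) `|expsum h (a%:R / d%:R : R)| ^+ 2 <= (d * h)%:R.
Proof.
move=> d0; pose F (n : nat) : R[i] := (n < h %% d)%:R.
have -> : \sum_(1 <= a < d) `|expsum h (a%:R / d%:R : R)| ^+ 2
    = \sum_(1 <= a < d) `|dft d F (a : nat)| ^+ 2.
  apply: eq_big_nat => a ad; rewrite expsum_modn //; congr (`|_| ^+ 2).
  rewrite /expsum /dft (big_ord_widen_cond _ predT (fun m => e (_ * m%:R))
    (ltnW (ltn_pmod h d0))) /= big_mkcond.
  apply: eq_bigr => n _; rewrite /F mulrAC.
  by case: ifP; rewrite ?mul1r ?mul0r.
(* Parseval needs the frequency 0 as well; its term is nonnegative. *)
apply: (@le_trans _ _ (\sum_(a < d) `|dft d F (a : nat)| ^+ 2)).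
  rewrite -(big_mkord predT (fun a : nat => `|dft d F a| ^+ 2)) [leRHS]big_ltn //.
  by rewrite lerDr exprn_ge0.
rewrite parseval // natrM ler_wpM2l //.
have -> : \sum_(n < d) `|F n| ^+ 2 = (h %% d)%:R; last by rewrite ler_nat leq_mod.
rewrite -[in RHS](card_ord (h %% d)) -sumr_const.
rewrite (big_ord_widen_cond _ predT (fun=> 1) (ltnW (ltn_pmod h d0))) [RHS]big_mkcond.
by apply: eq_bigr => n _; rewrite /F normr_nat /=; case: ifP; rewrite ?expr1n ?expr0n.
Qed.

Lemma sum_multiples (T : pzRingType) (p M : nat) (G : nat -> T) : (0 < p)%N ->
  \sum_(1 <= a < M * p) (p %| a)%:R * G a = \sum_(1 <= a < M) G (a * p)%N.
Proof.
move=> p0; case: M => [|M]; first by rewrite mul0n !big_geq.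
elim: M => [|M IH].
  rewrite mul1n [RHS]big_geq // big1_seq // => a /=.
  by rewrite mem_index_iota => /andP[a0 ap]; rewrite gtnNdvd // mul0r.
rewrite [RHS]big_nat_recr //= -IH mulSnr (@big_cat_nat _ _ _ (M.+1 * p)) //=; last first.
- exact: leq_addr.
- by rewrite muln_gt0.
have Mp : (M.+1 * p < M.+1 * p + p)%N by rewrite -[ltnLHS]addn0 ltn_add2l.
(* In the last block of length [p], only the left endpoint is a multiple of [p]. *)
congr (_ + _); rewrite big_ltn // dvdn_mull // mul1r.
rewrite big1_seq ?addr0 // => a /=; rewrite mem_index_iota => /andP[Ma ap].
have [/dvdnP[k ak]|] := boolP (p %| a)%N; last by rewrite mul0r.
move: Ma ap; rewrite ak -mulSnr !ltn_pmul2r // ltnS => /leq_trans h /h.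
by rewrite ltnn.
Qed.

(* The modulus [d] makes the induction on [s] go through: in the factor of [p]
   the term [A p] keeps the fractions [a / (d * prod s)], while [B p / p]
   replaces [d] by [d * p]. *)
Lemma expsum_sieve_sum (R : realType) (h : nat) (s : seq nat) (A B : nat -> R[i]) :
  uniq s -> all prime s -> (forall p, 0 <= A p) -> (forall p, 0 <= B p) ->
  forall d : nat, (0 < d)%N ->
  \sum_(1 <= a < d * \prod_(p <- s) p)
    (\prod_(p <- s) ((p %| a)%:R * A p + B p / p%:R))
      * `|expsum h (a%:R / (d * \prod_(p <- s) p)%:R : R)| ^+ 2
  <= (d * h)%:R * \prod_(p <- s) (A p + B p).
Proof.
move=> us ps A0 B0; elim: s us ps => [|p s IH] /=.
  move=> _ _ d d0; rewrite !big_nil muln1 mulr1.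
  by under eq_bigr do rewrite big_nil mul1r; apply: expsum_sq_sum.
move=> /andP[pNs us] /andP[pp ps] d d0; have p0 := prime_gt0 pp.
have pR (F : numFieldType) : p%:R != 0 :> F by rewrite pnatr_eq0 -lt0n.
under eq_bigr do rewrite big_cons !mulrDl -!mulrA.
rewrite big_split /= !big_cons; set Q := (\prod_(r <- s) r)%N in IH *.
rewrite mulrDl mulrDr; apply: lerD.
  (* The [A p] part: only multiples of [p] survive, and a p/(d Q p) = a/(d Q). The other primes [r]
     differ from [p], so [r] divides a p exactly when it divides a. *)
  have -> : (d * (p * Q) = d * Q * p)%N by rewrite mulnCA mulnC.
  rewrite sum_multiples // -mulr_sumr mulrCA ler_wpM2l //.
  apply: le_trans (IH us ps d d0); rewrite le_eqVlt; apply/orP; left; apply/eqP.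
  apply: eq_bigr => a _; congr (_ * `|expsum h _| ^+ 2).
    apply: eq_big_seq => r rs; have rp := allP ps r rs.
    rewrite Gauss_dvdl // prime_coprime // dvdn_prime2 //.
    by apply: contraNneq pNs => <-.
  by rewrite natrM [(d * Q * p)%:R]natrM -mulf_div (divff (pR R)) mulr1.
(* The [B p] part: the induction hypothesis at [d * p] costs an extra factor [p], which the
   denominator of [B p / p] absorbs. *)
rewrite -!mulr_sumr mulnA mulrA.
apply: le_trans (ler_wpM2l _ (IH us ps (d * p)%N _)) _.
- by rewrite divr_ge0.
- by rewrite muln_gt0 d0.
rewrite le_eqVlt; apply/orP; left; apply/eqP; move: (\prod_(j <- s) _) => P.
by rewrite !natrM; field; apply: pR.
Qed.

(** * Variance of window sums of a periodic function *)

Lemma sum_shift (T : pzRingType) (q j : nat) (F : nat -> T) : (0 < q)%N ->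
  (forall n, F (n %% q)%N = F n) -> \sum_(n < q) F (n + j)%N = \sum_(n < q) F n.
Proof.
move=> q0 Fq; elim: j => [|j <-]; first by under eq_bigr do rewrite addn0.
(* With [F j] added, both sides equal a sum over [q.+1] consecutive arguments: one peels off its
   first term, the other its last, [F (q + j)], equal to [F j] by periodicity. *)
apply: (addrI (F j)); rewrite [RHS]addrC.
transitivity (\sum_(n < q.+1) F (n + j)%N).
  by rewrite big_ord_recl; congr (_ + _); apply: eq_bigr => n _; rewrite addnS.
by rewrite big_ord_recr /= -[F (q + j)%N]Fq modnDl Fq.
Qed.

Lemma dft_shift (R : realType) (q j : nat) (F : nat -> R[i]) (a : int) :
  (0 < q)%N -> (forall n, F (n %% q)%N = F n) ->
  dft q (fun n => F (n + j)%N) a = e (- (a%:~R * j%:R / q%:R)) * dft q F a.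
Proof.
move=> q0 Fq; rewrite /dft.
rewrite -(@sum_shift _ q j (fun n => F n * e (a%:~R * n%:R / q%:R))) //; last first.
  by move=> n; rewrite Fq e_frac_modn.
rewrite mulr_sumr; apply: eq_bigr => n _; rewrite [RHS]mulrCA -eD; congr (_ * e _).
by rewrite natrD; ring.
Qed.

(** Parseval is applied to the centred window sum. Shifts become phases, so at nonzero frequencies
    its transform is that of [F] times the conjugate of [expsum], up to a factor of modulus 1; the
    value [m], being the mean of [F], cancels frequency 0. *)
Lemma window_variance (R : realType) (q h : nat) (F : nat -> R[i]) (m : R[i]) :
  (0 < q)%N -> (forall n, F (n %% q)%N = F n) -> \sum_(n < q) F n = q%:R * m ->
  q%:R * \sum_(n < q) `|\sum_(j < h) F (n + j.+1)%N - h%:R * m| ^+ 2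
  = \sum_(1 <= a < q) `|dft q F (a : nat)| ^+ 2 * `|expsum h (a%:R / q%:R : R)| ^+ 2.
Proof.
move=> q0 Fq Fm.
rewrite -(parseval (fun n => \sum_(j < h) F (n + j.+1)%N - h%:R * m)) //.
set S := fun n : nat => _.
have dftS (a : nat) : dft q S a = dft q F a
    * (e (a%:R / q%:R) * expsum h (a%:R / q%:R))^*%C
    - h%:R * m * \sum_(n < q) e (a%:~R * n%:R / q%:R : R).
  transitivity (\sum_(j < h) dft q (fun n => F (n + j.+1)%N) a
      - h%:R * m * \sum_(n < q) e (a%:~R * n%:R / q%:R : R)).
    rewrite /dft exchange_big /= mulr_sumr -sumrB; apply: eq_bigr => n _.
    by rewrite mulrBl mulr_suml.
  congr (_ - _); rewrite /expsum mulr_sumr.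
  have -> : (\sum_(j < h) e (a%:R / q%:R) * e (a%:R / q%:R * j%:R : R))^*%C
      = \sum_(j < h) e (- (a%:~R * j.+1%:R / q%:R) : R).
    rewrite [LHS]rmorph_sum; apply: eq_bigr => j _.
    rewrite -conj_e; congr conjc; rewrite -eD; congr (e _).
    by rewrite -natr1 -pmulrn; ring.
  rewrite mulr_sumr; apply: eq_bigr => j _.
  by rewrite dft_shift // mulrC.
rewrite -(big_mkord predT (fun a : nat => `|dft q S a| ^+ 2)) /= big_ltn //.
rewrite [X in X + _](_ : _ = 0) ?add0r; last first.
  rewrite dftS sum_e // dvdz0 mul0r e0 mul1r /expsum.
  under eq_bigr do rewrite mul0r e0.
  rewrite sumr_const card_ord conjc_nat /dft.
  under eq_bigr do rewrite !mul0r e0 mulr1.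
  rewrite Fm [X in `|X|](_ : _ = 0) ?normr0 ?expr0n //.
  by ring.
(* For 0 < a < q the constant [h%:R * m] has zero transform. The phase [e (a / q)], due to windows
   starting at n + 1, disappears in the norm. *)
apply: eq_big_nat => a /andP[a0 aq]; rewrite dftS sum_e // ifN ?mulr0 ?subr0.
  by rewrite normrM normcJ normrM norm_e mul1r exprMn.
by rewrite dvdzE /= gtnNdvd.
Qed.

(** * Fourier transform of the local indicator at a prime *)

Lemma sum_Zp (T : nmodType) (p : nat) (K : nat -> T) : (1 < p)%N ->
  \sum_(x : 'Z_p) K x = \sum_(n < p) K n.
(* The type ['Z_p] has exactly [p] elements only for p > 1, since its definition forces at least
   two. *)
Proof. by move=> p1; rewrite -(big_mkord predT K) /= Zp_cast // big_mkord. Qed.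

Lemma sum_Zp_in (T : nmodType) (p : nat) (D : {set 'Z_p}) (G : nat -> T) :
  (1 < p)%N ->
  \sum_(x in D) G x = \sum_(n < p) if (n%:R : 'Z_p) \in D then G n else 0.
Proof.
move=> p1; rewrite -(sum_Zp (fun n => if (n%:R : 'Z_p) \in D then G n else 0)) //.
by rewrite big_mkcond; apply: eq_bigr => x _; rewrite natr_Zp.
Qed.

Lemma sum_notin (T : pzRingType) (p : nat) (D : {set 'Z_p}) : (1 < p)%N ->
  \sum_(n < p) ((n%:R : 'Z_p) \notin D)%:R = p%:R - #|D|%:R :> T.
Proof.
move=> p1; rewrite -sumr_const (sum_Zp_in D (fun=> 1)) //.
rewrite -[in p%:R](card_ord p) -sumr_const -sumrB; apply: eq_bigr => n _.
by case: (_ \in D); rewrite ?subrr ?subr0.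
Qed.

Lemma dft_notin (R : realType) (p : nat) (D : {set 'Z_p}) (a : int) : (1 < p)%N ->
  dft p (fun n => ((n%:R : 'Z_p) \notin D)%:R) a
  = (if (p %| a)%Z then p%:R else 0)
    - \sum_(x in D) e (a%:~R * (x : nat)%:R / p%:R : R).
Proof.
move=> p1; rewrite -(sum_e R) ?(ltnW p1) //.
rewrite (sum_Zp_in D (fun n => e (a%:~R * n%:R / p%:R))) // -sumrB.
apply: eq_bigr => n _.
by case: (_ \in D); rewrite ?mul0r ?mul1r ?subrr ?subr0.
Qed.

Lemma sqr_norm_real (R : realType) (x : R) : `|x%:C| ^+ 2 = (x ^+ 2)%:C.
Proof. by rewrite sqr_normc conjc_real -rmorphM. Qed.

(** If [p] divides [a], every phase is 1 and the transform is exactly (1 - c) p, the [c'] term being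
    slack. Otherwise only the exponential sum over [D] remains, and c'^2 p = p^2 (c'^2 / p). *)
Lemma dft_notin_le (R : realType) (p : nat) (D : {set 'Z_p}) (c c' : R) (a : int) :
  (1 < p)%N -> #|D|%:R = c * p%:R ->
  ((a != 0 %[mod p])%Z ->
    `|\sum_(x in D) e (a%:~R * (x : nat)%:R / p%:R : R)|
      < (c' * Num.sqrt p%:R)%:C) ->
  `|dft p (fun n => ((n%:R : 'Z_p) \notin D)%:R) a : R[i]| ^+ 2
  <= p%:R ^+ 2 * ((p %| a)%Z%:R * ((1 - c) ^+ 2)%:C + (c' ^+ 2)%:C / p%:R).
Proof.
move=> p1 cD c'D; have p0 := ltnW p1.
have B0 : 0 <= (c' ^+ 2)%:C / p%:R :> R[i] by rewrite divr_ge0 // ler0c sqr_ge0.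
rewrite dft_notin //; case: ifPn => pa.
  have -> : \sum_(x in D) e (a%:~R * (x : nat)%:R / p%:R : R) = (c * p%:R)%:C.
    rewrite -cD rmorph_nat -sumr_const; apply: eq_bigr => x _.
    by move: (e_frac_eq1 R (a * (x : nat)%:Z) p0); rewrite dvdz_mulr // intrM => /eqP.
  rewrite mul1r -[X in X <= _]addr0 mulrDr.
  apply: lerD; last by rewrite mulr_ge0 // exprn_ge0.
  rewrite -(rmorph_nat (real_complex R)) -rmorphB sqr_norm_real -rmorphXn -rmorphM.
  by rewrite lecR le_eqVlt; apply/orP; left; apply/eqP; ring.
rewrite sub0r normrN mul0r add0r.
have /c'D lt : (a != 0 %[mod p])%Z by rewrite mod0z; apply: contra pa => /eqP/dvdz_mod0P.
(* Squaring requires [c' * Num.sqrt p%:R] to be nonnegative; this holds because it exceeds a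
   norm. *)
apply: le_trans (_ : (c' * Num.sqrt p%:R)%:C ^+ 2 <= _).
  by rewrite lerXn2r ?nnegrE ?(ltW lt) // (le_trans _ (ltW lt)).
rewrite -rmorphXn exprMn sqr_sqrtr // rmorphM rmorph_nat le_eqVlt.
apply/orP; left; apply/eqP; field.
by rewrite pnatr_eq0 -lt0n.
Qed.

(** * Square-free moduli, sifted counts and the final bound *)

Lemma prod_primes_squarefree (q : nat) :
  (0 < q)%N -> squarefree q -> (\prod_(p <- primes q) p)%N = q.
Proof.
move=> q0 sq; rewrite [RHS]prod_prime_decomp // prime_decompE big_map /=.
apply: eq_big_seq => p; rewrite mem_primes => /and3P[pp _ pq].
have : (0 < logn p q)%N by rewrite logn_gt0 mem_primes pp q0.
case E : (logn p q) => [//|[|k]] _; first by rewrite expn1.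
have /sq p1 : (p ^ 2 %| q)%N by rewrite pfactor_dvdn // E.
by rewrite p1 in pp.
Qed.

Lemma prodr_bool (T : pzSemiRingType) (I : Type) (s : seq I) (P : pred I) :
  \prod_(i <- s) (P i)%:R = (all P s)%:R :> T.
Proof.
elim: s => [|i s IH]; first by rewrite big_nil.
by rewrite big_cons IH /=; case: (P i); rewrite ?mul1r ?mul0r.
Qed.

(** This puts the count in the form of a window sum, as [window_variance] requires, of a product of
    local indicators, to which the factorization over primes applies. *)
Lemma sifted_countE (T : pzSemiRingType) (q : nat)
    (Omega : forall p : nat, {set 'Z_p}) (n h : nat) :
  (sifted_count q Omega n h)%:R
  = \sum_(j < h) \prod_(p <- primes q) (((n + j.+1)%:R : 'Z_p) \notin Omega p)%:R
  :> T.
Proof.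
under eq_bigr do rewrite prodr_bool.
rewrite /sifted_count /index_iota subSS addKn.
elim: h => [|h IH]; first by rewrite big_ord0.
rewrite -[X in iota _ X]addn1 iotaD count_cat natrD IH big_ord_recr /=.
by rewrite addn0 addSnnS.
Qed.

Theorem theorem4p2 (R : realType) (q : nat) (eps : R) (h : nat)
    (Omega : forall p : nat, {set 'Z_p}) (c c' : nat -> R)
    (q_gt0 : (0 < q)%N) (q_sqf : squarefree q)
    (eps_gt0 : 0 < eps) (h_gt0 : (0 < h)%N)
    (c_lt1 : forall p : nat, prime p -> (p %| q)%N -> c p < 1)
    (c'_lt1 : forall p : nat, prime p -> (p %| q)%N -> c' p < 1)
    (card_Omega : forall p : nat, prime p -> (p %| q)%N ->
       #|Omega p|%:R = c p * p%:R)
    (card_Omega_compl : forall p : nat, prime p -> (p %| q)%N ->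
       p%:R - #|Omega p|%:R > p%:R `^ (1 / 2 + eps))
    (exp_sum_lt : forall p : nat, prime p -> (p %| q)%N ->
       forall a : int, (a != 0 %[mod p])%Z ->
       `| \sum_(x in Omega p) e (a%:~R * (x : nat)%:R / p%:R : R) |
         < (c' p * Num.sqrt p%:R)%:C) :
  \sum_(0 <= n < q)
     ((sifted_count q Omega n h)%:R
      - h%:R * \prod_(p <- primes q) ((p%:R - #|Omega p|%:R) / p%:R)) ^+ 2
  <= q%:R * h%:R * \prod_(p <- primes q) ((1 - c p) ^+ 2 + c' p ^+ 2).
Proof.
have ps : all prime (primes q) by apply/allP => p; rewrite mem_primes => /andP[].
have pq p : p \in primes q -> prime p /\ (p %| q)%N.
  by rewrite mem_primes => /and3P[].
have us := primes_uniq q.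
have qE := prod_primes_squarefree q_gt0 q_sqf.
set m := \prod_(p <- primes q) ((p%:R - #|Omega p|%:R) / p%:R).
pose F p n : R[i] := ((n%:R : 'Z_p) \notin Omega p)%:R.
pose f n := \prod_(p <- primes q) F p n.
pose A p : R[i] := ((1 - c p) ^+ 2)%:C; pose B p : R[i] := (c' p ^+ 2)%:C.
have A0 p : 0 <= A p by rewrite ler0c sqr_ge0.
have B0 p : 0 <= B p by rewrite ler0c sqr_ge0.
have Fp p : p \in primes q -> forall n, F p (n %% p)%N = F p n.
  by move=> /pq[pp _] n; rewrite /F Zp_nat_mod // prime_gt1.
have fq n : f (n %% q)%N = f n.
  by apply: eq_big_seq => p p_in; rewrite -Fp // modn_dvdm ?Fp //; case: (pq p p_in).
have sum_f : \sum_(n < q) f n = q%:R * m%:C.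
  transitivity (\sum_(n < \prod_(p <- primes q) p) f n); first by rewrite qE.
  rewrite -[X in X%:R * _]qE sum_prod_prime // natr_prod /m rmorph_prod -big_split /=.
  apply: eq_big_seq => p /pq[pp _].
  have p0 : p%:R != 0 :> R[i] by rewrite pnatr_eq0 -lt0n prime_gt0.
  rewrite sum_notin ?prime_gt1 // rmorphM fmorphV rmorphB /= !rmorph_nat.
  by rewrite mulrCA divff ?mulr1.
have dft_f (a : nat) : `|dft q f a| ^+ 2
    <= q%:R ^+ 2 * \prod_(p <- primes q) ((p %| a)%:R * A p + B p / p%:R).
  have [b [b_dvd b_e]] := e_partial_fraction R us ps a.
  have -> : dft q f a = \prod_(p <- primes q) dft p (F p) (b p).
    rewrite /dft -(@sum_prod_prime _ _
      (fun p n => F p n * e ((b p)%:~R * n%:R / p%:R))) //; last first.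
      by move=> p p_in n; rewrite Fp // e_frac_modn // prime_gt0 //; case: (pq p p_in).
    by rewrite qE; apply: eq_bigr => n _; rewrite big_split /= -b_e qE.
  (* Both sides are now products over [p], compared factor by factor; [b p] and [a] have the same
     divisibility by [p]. *)
  rewrite normr_prod -prodrXl -[in X in X ^+ 2]qE natr_prod -prodrXl -big_split /=.
  rewrite [leLHS]big_seq [leRHS]big_seq; apply: ler_prod => p p_in.
  have [pp pdq] := pq p p_in; rewrite exprn_ge0 //=.
  have <- : (p %| b p)%Z = (p %| a)%N by rewrite b_dvd // dvdzE.
  by apply: dft_notin_le; [exact: prime_gt1 | exact: card_Omega | exact: exp_sum_lt].
have qC : 0 < q%:R :> R[i] by rewrite ltr0n.
rewrite -lecR -(ler_pM2l qC) big_mkord rmorph_sum /=.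
have -> : q%:R * \sum_(n < q) (((sifted_count q Omega n h)%:R - h%:R * m) ^+ 2)%:C
    = q%:R * \sum_(n < q) `|\sum_(j < h) f (n + j.+1)%N - h%:R * m%:C| ^+ 2.
  congr (_ * _); apply: eq_bigr => n _.
  by rewrite -sqr_norm_real rmorphB rmorphM /= !rmorph_nat sifted_countE.
rewrite (window_variance h q_gt0 fq sum_f).
apply: le_trans (_ : q%:R ^+ 2 * \sum_(1 <= a < q)
    (\prod_(p <- primes q) ((p %| a)%:R * A p + B p / p%:R))
    * `|expsum h (a%:R / q%:R : R)| ^+ 2 <= _).
  rewrite mulr_sumr; apply: ler_sum => a _.
  by rewrite mulrA ler_wpM2r // exprn_ge0.
(* One [q] cancels the one multiplied in for [window_variance], the other is the [q] of the bound.
   What is left is [expsum_sieve_sum] at d = 1. *)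
rewrite expr2 -mulrA ler_pM2l // !rmorphM /= !rmorph_nat -mulrA ler_pM2l //.
have := expsum_sieve_sum h us ps A0 B0 (isT : 0 < 1)%N.
rewrite !mul1n qE => le_sum.
rewrite rmorph_prod; under [X in _ <= _ * X]eq_bigr do rewrite rmorphD.
exact: le_sum.
Qed.
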